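(* Let $q\in(0,1]$, let $n\ge 0$ be an integer, let $b^n_{ijk}\in\mathbb{R}$ be given for all integers $i,j,k\ge 0$ with $i+j+k=n$, and let $$\gamma^n(u,v)=\sum_{i+j+k=n}b^n_{ijk}B^n_{ijk}(u,v).$$ Given $u,v$, define quantities $f^{(r)}_{ijk}$, for $0\le r\le n$ and all integers $i,j,k\ge 0$ with $i+j+k=n-r$, recursively by $$f^{(0)}_{ijk}=b^n_{ijk},$$ and, for $1\le r\le n$, $$f^{(r)}_{ijk}=q^k u\,f^{(r-1)}_{i+1,j,k}+q^k v\,f^{(r-1)}_{i,j+1,k}+(1-q^ku-q^kv)\,f^{(r-1)}_{i,j,k+1}.$$ Then $\gamma^n(u,v)=f^{(n)}_{000}$.
   Context: For a real number $q>0$ and a natural number $r$, the $q$-integer is $[r]=1+q+\cdots+q^{r-1}$ (so $[r]=r$ if $q=1$, and $[0]=0$). The $q$-factorial is $[r]!=[r][r-1]\cdots[1]$ with $[0]!=1$. The $q$-binomial coefficient is $\genfrac{[}{]}{0pt}{}{i}{j}=\frac{[i]!}{[j]!\,[i-j]!}$ if $i\ge j\ge 0$, and $0$ otherwise. For an integer $n\ge 0$ and integers $i,j,k\ge 0$ with $i+j+k=n$, the triangular $q$-Bernstein polynomial is $$B^n_{ijk}(u,v)=\genfrac{[}{]}{0pt}{}{n}{k}\binom{i+j}{i}u^iv^j\prod_{s=0}^{k-1}(1-q^su-q^sv),$$ where an empty product equals $1$. Here $u,v$ are real numbers (the first two barycentric coordinates of an arbitrary point of the plane with respect to a triangle). Sums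 over $i+j+k=n$ range over nonnegative integers $i,j,k$. *)

(* Defs.v *)
From mathcomp Require Import all_boot all_order all_algebra.
From mathcomp Require Import reals.

Set Implicit Arguments.
Unset Strict Implicit.
Unset Printing Implicit Defensive.

Import Order.TTheory GRing.Theory Num.Theory.
Local Open Scope ring_scope.

Definition qint (R : realType) (q : R) (r : nat) : R :=
  \sum_(s < r) q ^+ s.

Definition qfact (R : realType) (q : R) (r : nat) : R :=
  \prod_(s < r) qint q s.+1.

Definition qbinom (R : realType) (q : R) (i j : nat) : R :=
  if (j <= i)%N then qfact q i / (qfact q j * qfact q (i - j)) else 0.

(* The factor [n choose k] uses n, so this is the Bernstein polynomial only
   when i + j + k = n. *)
Definition qbernstein (R : realType) (q : R) (n i j k : nat) (u v : R) : R :=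
  qbinom q n k * 'C(i + j, i)%:R * u ^+ i * v ^+ j *
  \prod_(s < k) (1 - q ^+ s * u - q ^+ s * v).

(* The control net b is indexed by all triples of naturals, but only its values
   at i + j + k = n are used. *)
Definition qbernstein_surface (R : realType) (q : R) (n : nat)
    (b : nat -> nat -> nat -> R) (u v : R) : R :=
  \sum_(i < n.+1) \sum_(j < n.+1) \sum_(k < n.+1 | (i + j + k == n)%N)
    b i j k * qbernstein q n i j k u v.

(* Step r of the algorithm at (i, j, k) depends on b only at triples of sum
   i + j + k + r; for i + j + k = n - r these are the triples of sum n. *)
Fixpoint deCasteljau (R : realType) (q : R) (b : nat -> nat -> nat -> R)
    (u v : R) (r i j k : nat) : R :=
  if r is r'.+1 then
    q ^+ k * u * deCasteljau q b u v r' i.+1 j k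
    + q ^+ k * v * deCasteljau q b u v r' i j.+1 k
    + (1 - q ^+ k * u - q ^+ k * v) * deCasteljau q b u v r' i j k.+1
  else b i j k.

(* Main.v *)
Require Import Defs.
From mathcomp Require Import all_boot all_order all_algebra.
From mathcomp Require Import reals.
From mathcomp Require Import zify ring.

Set Implicit Arguments.
Unset Strict Implicit.
Unset Printing Implicit Defensive.

Import Order.TTheory GRing.Theory Num.Theory.
Local Open Scope ring_scope.

(** Starting the algorithm at height [k] amounts to replacing [(u, v)] by
    [(q ^+ k * u, q ^+ k * v)], so an induction on the number of steps reduces
    the claim to a one-step recurrence for the surface:
    [B^(n+1)_ijk(u, v) = u B^n_(i-1)jk(u, v) + v B^n_i(j-1)k(u, v)
       + (1 - u - v) B^n_ij(k-1)(q u, q v)].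
    The first two terms combine by the ordinary Pascal rule, the third one
    carries a factor [q ^+ (i + j)] and is absorbed by the q-Pascal rule. *)

Lemma qint_gt0 (R : realType) (q : R) (r : nat) : 0 < q -> 0 < qint q r.+1.
Proof.
move=> q0; rewrite /qint big_ord_recl expr0 ltr_pwDl //.
by apply: sumr_ge0 => s _; rewrite exprn_ge0 // ltW.
Qed.

Lemma qintD (R : realType) (q : R) (m r : nat) :
  qint q (m + r) = qint q m + q ^+ m * qint q r.
Proof.
rewrite /qint big_split_ord mulr_sumr; congr (_ + _).
by apply: eq_bigr => s _; rewrite exprD.
Qed.

Lemma qfactS (R : realType) (q : R) (r : nat) :
  qfact q r.+1 = qfact q r * qint q r.+1.
Proof. by rewrite /qfact big_ord_recr. Qed.

(** This is where [0 < q] enters: it makes every denominator in a q-binomial coefficient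
    invertible. *)
Lemma qfact_neq0 (R : realType) (q : R) (r : nat) : 0 < q -> qfact q r != 0.
Proof. by move=> q0; apply/prodf_neq0 => s _; rewrite gt_eqF ?qint_gt0. Qed.

Lemma qbinom0 (R : realType) (q : R) (n : nat) : 0 < q -> qbinom q n 0 = 1.
Proof.
by move=> q0; rewrite /qbinom subn0 {2}/qfact big_ord0 mul1r divff ?qfact_neq0.
Qed.

Lemma qbinom_small (R : realType) (q : R) (n k : nat) :
  (n < k)%N -> qbinom q n k = 0.
Proof. by rewrite /qbinom ltnNge => /negbTE ->. Qed.

Lemma qbinomnn (R : realType) (q : R) (n : nat) : 0 < q -> qbinom q n n = 1.
Proof.
by move=> q0; rewrite /qbinom leqnn subnn {3}/qfact big_ord0 mulr1 divff
  ?qfact_neq0.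
Qed.

(** Over a common denominator this is the splitting [[m + k + 1] = [m] + q ^+ m * [k + 1]]. Writing
    the upper index as a sum keeps truncated subtraction out of the exponent. *)
Lemma qbinomS (R : realType) (q : R) (m k : nat) : 0 < q ->
  qbinom q (m + k).+1 k.+1 =
  qbinom q (m + k) k.+1 + q ^+ m * qbinom q (m + k) k.
Proof.
move=> q0; case: m => [|m].
  by rewrite !add0n !qbinomnn // qbinom_small // add0r mul1r.
have le1 : (k.+1 <= m.+1 + k)%N by lia.
rewrite /qbinom ltnS le1 leq_addl subSS addnK.
have -> : (m.+1 + k - k.+1 = m)%N by lia.
rewrite qfactS -addnS qintD !(qfactS q k) !(qfactS q m).
have := qfact_neq0 m q0; have := qfact_neq0 k q0.
have := lt0r_neq0 (qint_gt0 m q0); have := lt0r_neq0 (qint_gt0 k q0).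
by move=> *; field; apply/and4P.
Qed.

(** The zero branches stand for Bernstein polynomials with a negative index. *)
Lemma qbernsteinS (R : realType) (q : R) (n i j k : nat) (u v : R) :
  0 < q -> (i + j + k = n.+1)%N ->
  qbernstein q n.+1 i j k u v =
  (if i is i'.+1 then u * qbernstein q n i' j k u v else 0) +
  (if j is j'.+1 then v * qbernstein q n i j' k u v else 0) +
  (if k is k'.+1 then
     (1 - u - v) * qbernstein q n i j k' (q * u) (q * v) else 0).
Proof.
move=> q0 eqn; set P := fun k => \prod_(s < k) (1 - q ^+ s * u - q ^+ s * v).
(* Splitting off the factor [s = 0] raises the other exponents by one, which amounts to evaluating
   at [(q * u, q * v)]. *)
have PS k' : P k'.+1 =
    (1 - u - v) * \prod_(s < k') (1 - q ^+ s * (q * u) - q ^+ s * (q * v)).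
  rewrite /P big_ord_recl expr0 !mul1r; congr (_ * _).
  by apply: eq_bigr => s _; rewrite !mulrA -!exprSr.
(* At [i = j = 0] the identity would read 1 = 0, hence the guard. *)
have pascal : (0 < i + j)%N -> 'C(i + j, i)%:R * u ^+ i * v ^+ j =
    (if i is i'.+1 then u * ('C(i' + j, i')%:R * u ^+ i' * v ^+ j) else 0) +
    (if j is j'.+1 then v * ('C(i + j', i)%:R * u ^+ i * v ^+ j') else 0).
  case: (i) (j) => [|i'] [|j'] // _.
  - by rewrite !bin0 !expr0 exprS; ring.
  - by rewrite !addn0 !binn !expr0 exprS; ring.
  - by rewrite addnS binS addSnnS natrD !exprS; ring.
have UV : (if i is i'.+1 then u * qbernstein q n i' j k u v else 0) +
    (if j is j'.+1 then v * qbernstein q n i j' k u v else 0) =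
    qbinom q n k * ('C(i + j, i)%:R * u ^+ i * v ^+ j) * P k.
  (* If [i + j = 0] then [k = n.+1], and [qbinom q n k = 0] makes both sides vanish. *)
  have [ij0|ij0] := posnP (i + j).
    rewrite (@qbinom_small _ _ n k) ?mul0r; last by lia.
    by case: (i) (j) ij0 => [|?] [|?] //; rewrite addr0.
  by rewrite pascal // /qbernstein -/(P k); case: (i); case: (j) => *; ring.
rewrite UV; case: k eqn {UV} => [|k] eqn.
  by rewrite /qbernstein -/(P 0%N) !qbinom0 // addr0 !mulrA.
have -> : n = (i + j + k)%N by lia.
(* The powers of [q * u] and [q * v] release [q ^+ (i + j)], exactly the weight in [qbinomS] with
   [m = i + j]. *)
rewrite {1}/qbernstein -/(P k.+1) qbinomS // PS /qbernstein !exprMn exprD.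
ring.
Qed.

Definition simplex_sum (V : nmodType) (n : nat) (F : nat -> nat -> nat -> V) : V :=
  \sum_(i < n.+1) \sum_(j < n.+1) \sum_(k < n.+1 | (i + j + k == n)%N) F i j k.

Lemma eq_simplex_sum (V : nmodType) (n : nat) (F G : nat -> nat -> nat -> V) :
  (forall i j k, (i + j + k = n)%N -> F i j k = G i j k) ->
  simplex_sum n F = simplex_sum n G.
Proof.
move=> FG; apply: eq_bigr => i _; apply: eq_bigr => j _.
by apply: eq_bigr => k /eqP /FG.
Qed.

Lemma simplex_sumD (V : nmodType) (n : nat) (F G : nat -> nat -> nat -> V) :
  simplex_sum n (fun i j k => F i j k + G i j k) =
  simplex_sum n F + simplex_sum n G.
Proof.
rewrite -big_split; apply: eq_bigr => i _.
by rewrite -big_split; apply: eq_bigr => j _; rewrite -big_split.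
Qed.

Lemma mulr_simplex_sumr (R : pzRingType) (n : nat) (a : R)
    (F : nat -> nat -> nat -> R) :
  a * simplex_sum n F = simplex_sum n (fun i j k => a * F i j k).
Proof.
rewrite mulr_sumr; apply: eq_bigr => i _.
by rewrite mulr_sumr; apply: eq_bigr => j _; rewrite mulr_sumr.
Qed.

(** The face [i = 0] contributes nothing. After the shift of [i], the ranges of [j] and [k] are one
    too long, but the value [n.+1] violates the sum constraint. *)
Lemma simplex_sum_recl1 (V : nmodType) (n : nat) (F : nat -> nat -> nat -> V) :
  (forall j k, F 0%N j k = 0) ->
  simplex_sum n.+1 F = simplex_sum n (fun i => F i.+1).
Proof.
move=> F0; rewrite /simplex_sum big_ord_recl big1 ?add0r; last first.
  by move=> j _; apply: big1.
apply: eq_bigr => i _; rewrite big_ord_recr /= [X in _ + X]big1 ?addr0; last first.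
  by move=> k; rewrite /bump /=; lia.
apply: eq_bigr => j _; rewrite big_mkcond big_ord_recr /= /bump /= ifF ?addr0; last lia.
by rewrite [RHS]big_mkcond; apply: eq_bigr => k _; rewrite add1n !addSn eqSS.
Qed.

Lemma simplex_sum_swap12 (V : nmodType) (n : nat) (F : nat -> nat -> nat -> V) :
  simplex_sum n F = simplex_sum n (fun i j k => F j i k).
Proof.
rewrite /simplex_sum exchange_big; apply: eq_bigr => i _; apply: eq_bigr => j _.
by apply: eq_bigl => k; rewrite (addnC j).
Qed.

Lemma simplex_sum_swap23 (V : nmodType) (n : nat) (F : nat -> nat -> nat -> V) :
  simplex_sum n F = simplex_sum n (fun i j k => F i k j).
Proof.
apply: eq_bigr => i _.
(* The constraint on [k] involves [j], so it moves into the summand before the sums are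
   exchanged. *)
under eq_bigr do rewrite big_mkcond.
rewrite exchange_big; apply: eq_bigr => j _.
by rewrite [RHS]big_mkcond; apply: eq_bigr => k _; rewrite addnAC.
Qed.

Lemma simplex_sum_recl2 (V : nmodType) (n : nat) (F : nat -> nat -> nat -> V) :
  (forall i k, F i 0%N k = 0) ->
  simplex_sum n.+1 F = simplex_sum n (fun i j => F i j.+1).
Proof.
move=> F0; rewrite simplex_sum_swap12 simplex_sum_recl1 //.
by rewrite simplex_sum_swap12.
Qed.

Lemma simplex_sum_recl3 (V : nmodType) (n : nat) (F : nat -> nat -> nat -> V) :
  (forall i j, F i j 0%N = 0) ->
  simplex_sum n.+1 F = simplex_sum n (fun i j k => F i j k.+1).
Proof.
move=> F0; rewrite simplex_sum_swap23 simplex_sum_recl2 //.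
by rewrite simplex_sum_swap23.
Qed.

Lemma qbernstein_surfaceE (R : realType) (q : R) (n : nat)
    (b : nat -> nat -> nat -> R) (u v : R) :
  qbernstein_surface q n b u v =
  simplex_sum n (fun i j k => b i j k * qbernstein q n i j k u v).
Proof. by []. Qed.

Lemma qbernstein_surfaceS (R : realType) (q : R) (n : nat)
    (b : nat -> nat -> nat -> R) (u v : R) : 0 < q ->
  qbernstein_surface q n.+1 b u v =
  u * qbernstein_surface q n (fun i => b i.+1) u v +
  v * qbernstein_surface q n (fun i j => b i j.+1) u v +
  (1 - u - v) *
    qbernstein_surface q n (fun i j k => b i j k.+1) (q * u) (q * v).
Proof.
move=> q0; rewrite !qbernstein_surfaceE; under eq_simplex_sum => i j k e
  do rewrite (qbernsteinS u v q0 e) !mulrDr.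
rewrite !simplex_sumD !mulr_simplex_sumr.
(* Each sum vanishes on the face where its own lowered index is 0, so it reindexes to a simplex of
   size [n]. *)
congr (_ + _ + _).
- rewrite simplex_sum_recl1; last by move=> *; rewrite mulr0.
  by apply: eq_simplex_sum => *; rewrite mulrCA.
- rewrite simplex_sum_recl2; last by move=> *; rewrite mulr0.
  by apply: eq_simplex_sum => *; rewrite mulrCA.
- rewrite simplex_sum_recl3; last by move=> *; rewrite mulr0.
  by apply: eq_simplex_sum => *; rewrite mulrCA.
Qed.

(** The recursion moves the base triple, so the induction needs it arbitrary: [i] and [j] only
    translate the net, while [k] also rescales the point. *)
Lemma deCasteljau_surface (R : realType) (q : R) (b : nat -> nat -> nat -> R)
    (u v : R) (r i j k : nat) : 0 < q ->
  deCasteljau q b u v r i j k =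
  qbernstein_surface q r (fun i' j' k' => b (i + i')%N (j + j')%N (k + k')%N)
    (q ^+ k * u) (q ^+ k * v).
Proof.
move=> q0; elim: r i j k => [|r IHr] i j k /=.
  rewrite /qbernstein_surface !big_ord1 big_mkcond big_ord1 /= !addn0.
  by rewrite /qbernstein qbinom0 // big_ord0 bin0 !expr0 !mulr1.
(* The point [(q * u, q * v)] in the third term of the recurrence supplies the extra factor [q] of
   height [k.+1]. *)
rewrite qbernstein_surfaceS // !IHr !mulrA -!exprS.
by congr (_ * _ + _ * _ + _ * _); rewrite !qbernstein_surfaceE;
  apply: eq_simplex_sum => *; rewrite addSnnS.
Qed.

Theorem proposition4p2 (R : realType) (q : R) (hq0 : 0 < q) (hq1 : q <= 1)
    (n : nat) (b : nat -> nat -> nat -> R) (u v : R) :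
  qbernstein_surface q n b u v = deCasteljau q b u v n 0 0 0.
Proof. by rewrite deCasteljau_surface // expr0 !mul1r. Qed.
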